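(* Let $X\subset\mathbb{CP}^3$ be the quadric hypersurface $\sum_{j=0}^2z_j^2-z_3^2=0$, and let $L\cong S^2$ be the real locus of $X$. The open Gromov–Witten invariants of $(X,L)$ are entirely determined by the axioms of $\mathrm{OGW}$, the closed Gromov–Witten invariants of $X$, and the open-closed relation. Moreover, the closed Gromov–Witten invariants of $X$ are entirely determined by the axioms of $\mathrm{GW}$, the WDVV equations, and the basic closed Gromov–Witten invariants, namely the two-point invariants $\mathrm{GW}_{d_1A_1+d_2A_2}(l\cup l^\star,\alpha)$, given as $$\mathrm{GW}_{d_1A_1+d_2A_2}(l\cup l^\star,\alpha)=\begin{cases}1,&(d_1,d_2,\alpha)\in\{(1,0,l),(0,1,l^\star)\},\\1,&(d_1,d_2,\alpha)=(0,0,l\cup l^\star),\\0,&\text{otherwise.}\end{cases}$$ (The axioms, the WDVV equations, the open-closed relation and the classes $A_i$, $l$, $l^\star$ are spelled out in the context.)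
   Context: Topology. $X$ carries the restriction of the Fubini–Study form, and $X\cong\mathbb{CP}^1\times\mathbb{CP}^1$. $A_1,A_2\in H_2(X;\mathbb{Z})$ are the classes of $\mathbb{CP}^1\times\{pt\}$ and $\{pt\}\times\mathbb{CP}^1$; $l=PD(A_1)$, $l^\star=PD(A_2)$ in $H^2(X;\mathbb{R})$, so $H^*(X;\mathbb{R})\cong\mathbb{R}[l,l^\star]/(l^2,(l^\star)^2)$. In the basic invariants, $\alpha$ ranges over the basis $1,l,l^\star,l\cup l^\star$. $L$ is the fixed locus of complex conjugation, with $[L]=A_1-A_2\neq0$ and $\Delta_L=PD([L])$. $L$ carries the unique relative spin structure with $w_{\mathfrak s}=0$. $\varpi:H_2(X;\mathbb{Z})\to H_2(X,L;\mathbb{Z})\cong\mathbb{Z}$ is the natural map, $c_1$ is the first Chern class of $X$, $\mu:H_2(X,L;\mathbb{Z})\to\mathbb{Z}$ is the Maslov index, and $n=2$. $\widehat H^*(X,L;\mathbb{R})$ is the cohomology of the complex of differential forms on $X$ with zero integral over $L$, and $\rho:\widehat H^*(X,L;\mathbb{R})\to H^*(X;\mathbb{R})$ is the natural map. Closed invariants. $\mathrm{GW}_{\hat\beta}:H^*(X;\mathbb{R})^{\otimes m}\to\mathbb{R}$, $\hat\beta\in H_2(X;\mathbb{Z})$, $m\ge0$, are the genus zero closed Gromov–Witten invariants. Axioms of $\mathrm{GW}$: (Degree) $\mathrm{GW}_{\hat\beta}(B_1,\dots,B_m)=0$ unless $2n-6+2c_1(\hat\beta)+2m=\sum_j|B_j|$.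 (Unit) $\mathrm{GW}_{\hat\beta}(1,B_1,\dots,B_{m-1})=\int_XB_1\wedge B_2$ if $(\hat\beta,m)=(0,3)$, and $0$ otherwise. (Zero) $\mathrm{GW}_0(B_1,\dots,B_m)=\int_XB_1\wedge B_2\wedge B_3$ if $m=3$, and $0$ otherwise. (Divisor) If $|B_m|=2$, then $\mathrm{GW}_{\hat\beta}(B_1,\dots,B_m)=\int_{\hat\beta}B_m\cdot\mathrm{GW}_{\hat\beta}(B_1,\dots,B_{m-1})$. WDVV equations. Let $\Delta_0,\dots,\Delta_3$ be a homogeneous basis of $H^*(X;\mathbb{R})$, $(g^{ij})$ the inverse of the matrix $(\int_X\Delta_i\wedge\Delta_j)$, and $\Phi=\sum_{\hat\beta,\,r_i\ge0}\frac{T^{\varpi(\hat\beta)}\prod_it_i^{r_i}}{\prod_ir_i!}\mathrm{GW}_{\hat\beta}(\otimes_i\Delta_i^{\otimes r_i})$ (there is no extra sign since $w_{\mathfrak s}=0$). For all indices $a,b,c,e$: $\sum_{i,j}\partial_{t_a}\partial_{t_b}\partial_{t_i}\Phi\cdot g^{ij}\cdot\partial_{t_j}\partial_{t_c}\partial_{t_e}\Phi=\sum_{i,j}\partial_{t_b}\partial_{t_c}\partial_{t_i}\Phi\cdot g^{ij}\cdot\partial_{t_j}\partial_{t_a}\partial_{t_e}\Phi$ (all classes have even degree, so no signs appear). Open invariants. $\mathrm{OGW}_{\beta,k}:\widehat H^*(X,L;\mathbb{R})^{\otimes m}\to\mathbb{R}$, $\beta\in H_2(X,L;\mathbb{Z})$,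 $k,m\ge0$, are the genus zero open Gromov–Witten invariants of Solomon–Tukachinsky defined via point-like bounding chains; they count configurations of $J$-holomorphic disks of total degree $\beta$ with $k$ boundary point constraints in $L$ and the given interior constraints. By definition $\mathrm{OGW}_{\beta,0}=0$ for $\beta\in\mathrm{Im}\,\varpi$. Axioms of $\mathrm{OGW}$: (Degree) $\mathrm{OGW}_{\beta,k}(B_1,\dots,B_m)=0$ unless $n-3+\mu(\beta)+k+2m=kn+\sum_j|B_j|$. (Unit) $\mathrm{OGW}_{\beta,k}(1,B_1,\dots,B_{m-1})=-1$ if $(\beta,k,m)=(0,1,1)$, and $0$ otherwise. (Zero) $\mathrm{OGW}_{0,k}(B_1,\dots,B_m)=-1$ if $(k,m)=(1,1)$ and $B_1=1$, and $0$ otherwise. (Divisor) If $|B_m|=2$, then $\mathrm{OGW}_{\beta,k}(B_1,\dots,B_m)=\int_\beta B_m\cdot\mathrm{OGW}_{\beta,k}(B_1,\dots,B_{m-1})$. Open-closed relation (valid since $[L]\ne0$). For $\eta_1,\dots,\eta_m\in\widehat H^*(X,L;\mathbb{R})$: $\mathrm{OGW}_{\beta,k}(\eta_1,\dots,\eta_m)=0$ if $k\ge2$, or if $k\ge1$ and $\beta\notin\mathrm{Im}\,\varpi$. For $\beta\in\mathrm{Im}\,\varpi$ and $\eta\in H^*(X;\mathbb{R})$ with $\int_L\eta=1$, $\mathrm{OGW}_{\beta,1}(\eta_1,\dots,\eta_m)=\sum_{\hat\beta:\,\varpi(\hat\beta)=\beta}(-1)^{n+1+w_{\mathfrak s}(\hat\beta)}\mathrm{GW}_{\hat\beta}(\eta,\Delta_L,\rho(\eta_1),\dots,\rho(\eta_m))$,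 where $w_{\mathfrak s}=0$.
   Formalization: The printed table and the literal GW Divisor and OGW Zero axioms are inconsistent: determination is proved for any table of basic invariants, with Divisor not required at degree 0 with m=3, and OGW Zero for (k,m)=(1,1) read on homogeneous classes; symmetry and finiteness of fibre sums are assumed. *)

(* Defs.v *)
From HB Require Import structures.
From mathcomp Require Import all_boot all_order all_algebra.
From mathcomp Require Import boolp classical_sets functions cardinality fsbigop.
From mathcomp Require Import reals.
Set Implicit Arguments.
Unset Strict Implicit.
Unset Printing Implicit Defensive.
Import GRing.Theory.
Local Open Scope classical_set_scope.
Local Open Scope ring_scope.

(** * Topology of the quadric X = CP^1 x CP^1 and of its real locus L = S^2 *)

(* n: the complex dimension of X, and the real dimension of L. *)
Definition qdim : nat := 2.

(* H_2(X;Z): the pair (d1, d2) stands for d1 A_1 + d2 A_2. *)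
Definition H2X : Type := (int * int)%type.

Definition A1 : H2X := (1, 0).
Definition A2 : H2X := (0, 1).
Definition classL : H2X := A1 - A2.

(* H_2(X,L;Z) is H_2(X;Z) / Z[L], because H_1(L) = 0; as [L] = A_1 - A_2, the
   map (d1, d2) |-> d1 + d2 identifies this quotient with Z. *)
Definition H2XL : Type := int.
Definition varpi (b : H2X) : H2XL := b.1 + b.2.

Definition chern1 (b : H2X) : int := 2 * b.1 + 2 * b.2.

(* The Maslov index restricts to 2 c_1 along varpi. *)
Definition maslov (beta : H2XL) : int := 4 * beta.

(* H^*(X;R) = R[l, l*] / (l^2, l*^2), in coordinates over 1, l, l*, l u l*. *)
Definition HX (R : realType) := 'rV[R]_4.

Definition i_one : 'I_4 := Ordinal (isT : (0 < 4)%N).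
Definition i_l : 'I_4 := Ordinal (isT : (1 < 4)%N).
Definition i_ls : 'I_4 := Ordinal (isT : (2 < 4)%N).
Definition i_pt : 'I_4 := Ordinal (isT : (3 < 4)%N).

Section Cohomology.
Variable R : realType.
Implicit Types (x y : HX R) (b : H2X).

Definition hbasis (i : 'I_4) : HX R := delta_mx 0 i.
Definition oneX : HX R := hbasis i_one.
Definition cl_l : HX R := hbasis i_l.
Definition cl_ls : HX R := hbasis i_ls.
Definition cl_pt : HX R := hbasis i_pt.

Definition cup x y : HX R :=
  (x 0 i_one * y 0 i_one) *: oneX
  + (x 0 i_one * y 0 i_l + x 0 i_l * y 0 i_one) *: cl_l
  + (x 0 i_one * y 0 i_ls + x 0 i_ls * y 0 i_one) *: cl_ls
  + (x 0 i_one * y 0 i_pt + x 0 i_l * y 0 i_ls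
     + x 0 i_ls * y 0 i_l + x 0 i_pt * y 0 i_one) *: cl_pt.

Definition hdeg (i : 'I_4) : nat := nth 0%N [:: 0; 2; 2; 4]%N i.

(* x is homogeneous of degree k; the zero class has every degree. *)
Definition homog (k : nat) x : bool :=
  [forall i : 'I_4, (x 0 i != 0) ==> (hdeg i == k)].

Definition intX x : R := x 0 i_pt.

(* l = PD(A_1) and l* = PD(A_2). *)
Definition PD b : HX R := b.1%:~R *: cl_l + b.2%:~R *: cl_ls.

Definition DeltaL : HX R := PD classL.

(* The integral over b of the degree 2 part of x. Note that l evaluates to 0
   on A_1 and to 1 on A_2, since A_1.A_1 = 0 and A_1.A_2 = 1. *)
Definition int2 b x : R := intX (cup x (PD b)).

Definition intL x : R^o := int2 classL x.

Fact int2E b x : int2 b x = b.2%:~R * x 0 i_l + b.1%:~R * x 0 i_ls.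
Proof.
rewrite /int2 /intX /cup /PD /cl_pt /cl_l /cl_ls /oneX /hbasis !mxE /=.
by rewrite !(mulr0, mulr1, add0r, addr0) mulrC [x 0 i_ls * _]mulrC.
Qed.

Fact intL_is_linear : linear intL.
Proof.
move=> a x y; rewrite /intL !int2E !mxE /GRing.scale /= !mulrDr !mulrA.
by rewrite ![_ * a]mulrC addrACA.
Qed.
HB.instance Definition _ :=
  GRing.isLinear.Build R (HX R) (R^o) _ intL intL_is_linear.

(* The cohomology of the complex of forms on X with zero integral over L:
   H^1(X;R) = 0 and the integral over L maps H^2(X;R) onto R, so by the long
   exact sequence rho is injective with image the kernel of that integral. *)
Definition HXL : Type := subvs_of (lker (linfun intL)).

Definition rho (u : HXL) : HX R := vsval u.

Fact intL_rho (u : HXL) : intL (rho u) = 0.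
Proof. by have := subvsP u; rewrite memv_ker lfunE => /eqP. Qed.

(* The integral over beta in H_2(X,L;Z), computed on a lift to H_2(X;Z). *)
Definition int2rel (beta : H2XL) (u : HXL) : R := int2 (beta, 0) (rho u).

Fact int2rel_varpi b (u : HXL) : int2rel (varpi b) u = int2 b (rho u).
Proof.
have := intL_rho u; rewrite /intL /int2rel !int2E /= subr0 sub0r.
rewrite mulrN1z mul1r mulN1r addrC => /eqP; rewrite subr_eq0 => /eqP ->.
by rewrite /varpi intrD mul0r add0r mulrDl addrC.
Qed.

End Cohomology.

(** * Closed invariants *)

(* A family of maps H^*(X;R)^{(x) m} -> R, m >= 0, indexed by H_2(X;Z): the
   arguments are listed in a sequence, whose size is m. *)
Definition closed_family (R : realType) := H2X -> seq (HX R) -> R.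

(* Sums over an infinite family, [\sum_(x \in A) F x] with A : set T, are those of
   fsbigop: the sum over the support of F when it is finite, and 0 otherwise.
   The first three fields express that the invariants are symmetric (all
   classes of X have even degree) multilinear maps, and the finiteness, given
   by Gromov compactness, without which the sums over the fibres of varpi below
   are meaningless. The divisor axiom is required outside (b, m) = (0, 3) only:
   there, it would contradict the zero axiom, e.g. on (1, l, l* ). *)
Record gw_axioms (R : realType) (GW : closed_family R) : Prop := GWAxioms {
  gw_multilinear : forall b (s1 s2 : seq (HX R)) (a : R) (x y : HX R),
    GW b (s1 ++ (a *: x + y) :: s2)
    = a * GW b (s1 ++ x :: s2) + GW b (s1 ++ y :: s2);
  gw_symmetric : forall b (s t : seq (HX R)), perm_eq s t -> GW b s = GW b t;
  gw_finite : forall (beta : H2XL) (s : seq (HX R)),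
    finite_set [set b : H2X | varpi b = beta /\ GW b s <> 0];
  gw_degree : forall b (s : seq (HX R)) (ks : seq nat),
    all2 (@homog R) ks s ->
    (2 * qdim)%N%:Z - 6 + 2 * chern1 b + (2 * size s)%N%:Z <> (sumn ks)%:Z ->
    GW b s = 0;
  gw_unit : forall b (s : seq (HX R)),
    GW b (oneX R :: s) =
      if s is [:: x; y] then (if b == 0 then intX (cup x y) else 0) else 0;
  gw_zero : forall s : seq (HX R),
    GW 0 s = if s is [:: x; y; z] then intX (cup (cup x y) z) else 0;
  gw_divisor : forall b (s : seq (HX R)) (x : HX R),
    homog 2 x -> (b, (size s).+1) <> (0, 3%N) ->
    GW b (rcons s x) = int2 b x * GW b s
}.

(** * WDVV equations *)

(* A monomial T^d t_0^{r_0} t_1^{r_1} t_2^{r_2} t_3^{r_3} is the pair (d, r);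
   the addition of pairs is the product of monomials, and a formal series is
   the function giving its coefficients. *)
Definition monom : Type := (int * {ffun 'I_4 -> nat})%type.
Definition series (R : realType) := monom -> R.

Definition partial (R : realType) (a : 'I_4) (f : series R) : series R :=
  fun m => (m.2 a).+1%:R * f (m.1, m.2 + [ffun i => nat_of_bool (i == a)]).

(* The power of T is unbounded a priori, but if f and g are derivatives of the
   potential below, the degree axiom leaves finitely many nonzero terms. *)
Definition mul_series (R : realType) (f g : series R) : series R :=
  fun m => \sum_(p \in [set p : monom * monom | p.1 + p.2 = m]) f p.1 * g p.2.

Section WDVV.
Variables (R : realType) (GW : closed_family R) (Delta : 4.-tuple (HX R)).

Definition insertion (r : {ffun 'I_4 -> nat}) : seq (HX R) :=
  flatten [seq nseq (r i) (tnth Delta i) | i <- enum 'I_4].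

Definition potential : series R := fun m =>
  (\prod_(i < 4) (m.2 i)`!)%:R^-1 *
  \sum_(b \in [set b : H2X | varpi b = m.1]) GW b (insertion m.2).

Definition ginv : 'M[R]_4 :=
  invmx (\matrix_(i, j) intX (cup (tnth Delta i) (tnth Delta j))).

Definition d3 (a b c : 'I_4) : series R :=
  partial a (partial b (partial c potential)).

Definition wdvv_for : Prop := forall (a b c e : 'I_4) (m : monom),
  \sum_(i < 4) \sum_(j < 4) ginv i j * mul_series (d3 a b i) (d3 j c e) m
  = \sum_(i < 4) \sum_(j < 4) ginv i j * mul_series (d3 b c i) (d3 j a e) m.

Definition homogeneous_basis : Prop :=
  basis_of fullv Delta /\ forall i, exists k, homog k (tnth Delta i).

End WDVV.

Definition wdvv (R : realType) (GW : closed_family R) : Prop :=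
  forall Delta : 4.-tuple (HX R), homogeneous_basis Delta -> wdvv_for GW Delta.

(** * Basic closed invariants *)

(* The two-point invariants GW_{d1 A_1 + d2 A_2}(l u l*, alpha), with alpha in
   the basis 1, l, l*, l u l*, are given by v. *)
Definition basic_invariants (R : realType) (v : int -> int -> 'I_4 -> R)
    (GW : closed_family R) : Prop :=
  forall (d1 d2 : int) (i : 'I_4),
    GW (d1, d2) [:: cl_pt R; hbasis R i] = v d1 d2 i.

(* Pitfall: with l = PD(A_1), no family satisfying [gw_axioms] takes these
   values: the zero axiom gives 0 at (0, 0, l u l* ), and the divisor axiom
   gives 0 at (1, 0, l) and (0, 1, l* ), the nonzero invariants in degree one
   being those at (1, 0, l* ) and (0, 1, l). *)
Definition quadric_values (R : realType) (d1 d2 : int) (i : 'I_4) : R :=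
  if (d1, d2, i) \in [:: (1, 0, i_l); (0, 1, i_ls)] then 1
  else if (d1, d2, i) == (0, 0, i_pt) then 1
  else 0.

(** * Open invariants *)

(* A family of maps HXL^{(x) m} -> R, indexed by H_2(X,L;Z) and by the number k
   of boundary constraints. *)
Definition open_family (R : realType) := H2XL -> nat -> seq (HXL R) -> R.

Definition in_im_varpi (beta : H2XL) : Prop := exists b, varpi b = beta.

(* The zero axiom is stated on homogeneous arguments when (k, m) = (1, 1), as
   multilinearity forces OGW_{0,1}(c.1) = - c. *)
Record ogw_axioms (R : realType) (OGW : open_family R) : Prop := OGWAxioms {
  ogw_multilinear :
    forall beta k (s1 s2 : seq (HXL R)) (a : R) (x y : HXL R),
    OGW beta k (s1 ++ (a *: x + y) :: s2)
    = a * OGW beta k (s1 ++ x :: s2) + OGW beta k (s1 ++ y :: s2);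
  ogw_symmetric : forall beta k (s t : seq (HXL R)),
    perm_eq s t -> OGW beta k s = OGW beta k t;
  ogw_no_boundary : forall beta (s : seq (HXL R)),
    in_im_varpi beta -> OGW beta 0 s = 0;
  ogw_degree : forall beta k (s : seq (HXL R)) (ds : seq nat),
    all2 (@homog R) ds (map (@rho R) s) ->
    qdim%:Z - 3 + maslov beta + k%:Z + (2 * size s)%N%:Z
      <> (k * qdim)%N%:Z + (sumn ds)%:Z ->
    OGW beta k s = 0;
  ogw_unit : forall beta k (u : HXL R) (s : seq (HXL R)),
    rho u = oneX R ->
    OGW beta k (u :: s) =
      if (beta, k, (size s).+1) == (0, 1%N, 1%N) then -1 else 0;
  ogw_zero_one : forall u : HXL R, rho u = oneX R -> OGW 0 1 [:: u] = -1;
  ogw_zero_pos : forall (u : HXL R) (d : nat),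
    homog d (rho u) -> (0 < d)%N -> OGW 0 1 [:: u] = 0;
  ogw_zero : forall k (s : seq (HXL R)),
    (k, size s) <> (1%N, 1%N) -> OGW 0 k s = 0;
  ogw_divisor : forall beta k (s : seq (HXL R)) (u : HXL R),
    homog 2 (rho u) -> OGW beta k (rcons s u) = int2rel beta u * OGW beta k s
}.

(* The relative spin structure has w = 0, so the sign is (-1)^(n+1). *)
Record open_closed (R : realType) (GW : closed_family R)
    (OGW : open_family R) : Prop := OpenClosed {
  oc_two_boundary : forall beta k (s : seq (HXL R)),
    (2 <= k)%N -> OGW beta k s = 0;
  oc_not_im : forall beta k (s : seq (HXL R)),
    (1 <= k)%N -> ~ in_im_varpi beta -> OGW beta k s = 0;
  oc_relation : forall beta (eta : HX R) (s : seq (HXL R)),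
    in_im_varpi beta -> intL eta = 1 ->
    OGW beta 1 s =
      \sum_(b \in [set b : H2X | varpi b = beta])
        (-1) ^+ qdim.+1 * GW b [:: eta, DeltaL R & map (@rho R) s]
}.

(* Main.v *)
(** The unit, zero and divisor axioms reduce every closed invariant to
    GW_b(pt, ..., pt), and the degree axiom leaves only the case of 2d - 1
    points, with d = varpi b >= 1. For d = 1 the divisor axiom reads the
    invariant off the two-point ones: b.2 GW_b(pt) and b.1 GW_b(pt) are both
    given, and b.1 + b.2 = 1. For d >= 2 one WDVV equation expresses the third
    derivative of the potential in the point direction through products of
    terms of lower degree. That equation only sees sums over the fibres of
    varpi; inserting p extra copies of l multiplies the summand at b by
    b.2 ^ p, and these moments separate the finitely many contributing b. *)
Require Import Defs.
From mathcomp Require Import all_boot all_order all_algebra.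
From mathcomp Require Import finmap.
From mathcomp Require Import boolp classical_sets functions cardinality fsbigop.
From mathcomp Require Import reals zify ring.
Set Implicit Arguments.
Unset Strict Implicit.
Unset Printing Implicit Defensive.
Import Order.TTheory GRing.Theory Num.Theory.
Local Open Scope classical_set_scope.
Local Open Scope ring_scope.

(** * Moments separate finitely many points *)

(** By linearity the powers may be replaced with any polynomial, and one that vanishes at every node
    but [x i] isolates [c i]. *)
Lemma sum_moments_eq0 (R : idomainType) (T : eqType) (r : seq T) (x c : T -> R) :
  uniq r -> {in r &, injective x} ->
  (forall p : nat, \sum_(i <- r) x i ^+ p * c i = 0) -> {in r, forall i, c i = 0}.
Proof.
move=> Ur xI mom i ri.
have polsum (q : {poly R}) : \sum_(j <- r) q.[x j] * c j = 0.
  under eq_bigr do rewrite horner_coef mulr_suml.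
  rewrite exchange_big big1 // => p _ /=.
  by under eq_bigr do rewrite -mulrA; rewrite -mulr_sumr mom mulr0.
pose q := \prod_(a <- map x (rem i r)) ('X - a%:P).
have := polsum q; rewrite (big_rem i ri) /= big_seq big1 => [|j rj]; last first.
  by rewrite [q.[_]](rootP _) ?mul0r // root_prod_XsubC map_f.
rewrite addr0 => /eqP; rewrite mulf_eq0 => /orP[|/eqP //].
rewrite -rootE root_prod_XsubC.
move=> /mapP[j]; rewrite mem_rem_uniq // inE => /andP[ji rj] /(xI _ _ ri rj) ij.
by rewrite ij eqxx in ji.
Qed.

(** Both sums live on the union [D] of the two finite supports, where [f - g] has vanishing
    moments. *)
Lemma fsum_moments_inj (R : idomainType) (T : choiceType) (A : set T)
    (x f g : T -> R) :
  {in A &, injective x} ->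
  finite_set [set i | A i /\ f i <> 0] -> finite_set [set i | A i /\ g i <> 0] ->
  (forall p : nat,
     \sum_(i \in A) x i ^+ p * f i = \sum_(i \in A) x i ^+ p * g i) ->
  forall i, A i -> f i = g i.
Proof.
move=> xI finf fing fg.
pose D := [set i | A i /\ f i <> 0] `|` [set i | A i /\ g i <> 0].
have finD : finite_set D by rewrite finite_setU.
have DA : D `<=` A by move=> i [] [].
have sumD (h : T -> R) p : {in A, forall i, ~ D i -> h i = 0} ->
    \sum_(i \in A) x i ^+ p * h i = \sum_(i <- fset_set D) x i ^+ p * h i.
  move=> h0; rewrite -fsbig_finite //; apply/esym/fsbig_widen => //.
  by move=> i [Ai Di] /=; rewrite h0 ?mulr0 // inE.
have f0 : {in A, forall i, ~ D i -> f i = 0}.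
  by move=> i; rewrite inE => Ai Di; apply: contra_notP Di => ?; left.
have g0 : {in A, forall i, ~ D i -> g i = 0}.
  by move=> i; rewrite inE => Ai Di; apply: contra_notP Di => ?; right.
have fgD : {in fset_set D, forall i, f i - g i = 0}.
  apply: (@sum_moments_eq0 _ _ _ x); first exact: fset_uniq.
    by move=> i j; rewrite !in_fset_set // !inE => /DA Di /DA Dj; apply: xI; rewrite inE.
  move=> p; under eq_bigr do rewrite mulrBr.
  by rewrite big_split /= sumrN -!sumD // fg subrr.
move=> i Ai; have [Di|Di] := pselect (D i).
  by apply/eqP; rewrite -subr_eq0 fgD // in_fset_set // inE.
by rewrite f0 ?g0 // inE.
Qed.

(** * The standard basis and its intersection form *)

Section Basis.
Variable R : realType.

Lemma ord4_ind (P : 'I_4 -> Prop) :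
  P i_one -> P i_l -> P i_ls -> P i_pt -> forall i, P i.
Proof.
move=> P0 P1 P2 P3 [[|[|[|[|//]]]] lti]; rewrite (bool_irrelevance lti isT) //.
Qed.

(** The nested form ending in [+ 0] lets [gw_multilinear] peel off one basis vector at a time. *)
Lemma HX_expand (x : HX R) :
  x = x 0 i_one *: oneX R + (x 0 i_l *: cl_l R
      + (x 0 i_ls *: cl_ls R + (x 0 i_pt *: cl_pt R + 0))).
Proof.
by apply/rowP; elim/ord4_ind; rewrite !mxE /=; ring.
Qed.

Lemma homog_hbasis (i : 'I_4) : homog (hdeg i) (hbasis R i).
Proof.
apply/forallP => j; apply/implyP; rewrite mxE /=.
by case: (j =P i) => [-> //|_]; rewrite eqxx.
Qed.

Lemma int2_l b : int2 b (cl_l R) = b.2%:~R.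
Proof. by rewrite int2E !mxE /= mulr1 mulr0 addr0. Qed.

Lemma int2_ls b : int2 b (cl_ls R) = b.1%:~R.
Proof. by rewrite int2E !mxE /= mulr1 mulr0 add0r. Qed.

Definition std_basis : 4.-tuple (HX R) := [tuple hbasis R i | i < 4].

Lemma tnth_std_basis i : tnth std_basis i = hbasis R i.
Proof. by rewrite tnth_mktuple. Qed.

Lemma std_basis_homogeneous : homogeneous_basis std_basis.
Proof.
split=> [|i]; last by exists (hdeg i); rewrite tnth_std_basis homog_hbasis.
rewrite basisEdim size_tuple dimvf dim_matrix andbT.
apply/subvP => x _; rewrite [x]HX_expand.
have memb i : hbasis R i \in <<std_basis>>%VS.
  by rewrite -tnth_std_basis memv_span ?mem_tnth.
by rewrite !memvD ?mem0v // memvZ //; apply: memb.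
Qed.

Lemma intX_cup_hbasis (i j : 'I_4) :
  intX (cup (hbasis R i) (hbasis R j)) = ((i + j)%N == 3%N)%:R.
Proof.
rewrite /intX /cup /cl_pt /cl_l /cl_ls /oneX /hbasis !mxE /=.
by elim/ord4_ind: i; elim/ord4_ind: j; rewrite /=; ring.
Qed.

(** The Gram matrix is the antidiagonal permutation matrix, which is its own inverse. *)
Lemma ginv_std (i j : 'I_4) : ginv std_basis i j = ((i + j)%N == 3%N)%:R.
Proof.
rewrite /ginv; set G := \matrix_(i, j) _.
have GE k l : G k l = ((k + l)%N == 3%N)%:R.
  by rewrite mxE !tnth_std_basis intX_cup_hbasis.
have GG : G *m G = 1%:M.
  apply/matrixP => k l; rewrite mxE !big_ord_recl big_ord0 !GE mxE /=.
  by elim/ord4_ind: k; elim/ord4_ind: l; rewrite /=; ring.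
have [Gu _] := mulmx1_unit GG.
by rewrite -(GE i j) -[invmx G]mulmx1 -GG mulKmx.
Qed.

Lemma sum_ginv_std (F : 'I_4 -> 'I_4 -> R) :
  \sum_(i < 4) \sum_(j < 4) ginv std_basis i j * F i j
  = F i_one i_pt + F i_l i_ls + F i_ls i_l + F i_pt i_one.
Proof.
rewrite (eq_bigr (fun i => F i (rev_ord i))) => [|i _].
  rewrite !big_ord_recl big_ord0 addr0 !addrA.
  by congr (F _ _ + F _ _ + F _ _ + F _ _); apply: val_inj.
rewrite (bigD1 (rev_ord i)) //= big1 => [|j /eqP ij].
  by rewrite ginv_std /= addr0; case: eqP; rewrite ?mul1r //; have := ltn_ord i; lia.
rewrite ginv_std; case: eqP => [E|_]; last by rewrite mul0r.
by case: ij; apply: val_inj => /=; lia.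
Qed.

Lemma insertion_std r :
  insertion std_basis r =
    nseq (r i_one) (oneX R) ++ nseq (r i_l) (cl_l R) ++ nseq (r i_ls) (cl_ls R)
    ++ nseq (r i_pt) (cl_pt R).
Proof.
rewrite /insertion !enum_ordSl /= !tnth_std_basis.
have -> : enum 'I_0 = [::] by apply: size0nil; rewrite size_enum_ord.
rewrite /= cats0.
by congr (nseq (r _) (hbasis R _) ++ nseq (r _) (hbasis R _) ++
  nseq (r _) (hbasis R _) ++ nseq (r _) (hbasis R _)); apply: val_inj.
Qed.

Lemma count_insertion (D : 4.-tuple (HX R)) (r : {ffun 'I_4 -> nat}) P :
  count P (insertion D r) = (\sum_(i < 4) P (tnth D i) * r i)%N.
Proof.
rewrite /insertion count_flatten -map_comp sumnE big_map big_enum.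
by apply: eq_bigr => i _; rewrite /= count_nseq.
Qed.

(** Differentiating in [t_a] inserts one more copy of [tnth D a]; its position is immaterial because
    the invariants are symmetric. *)
Lemma insertionD1 (D : 4.-tuple (HX R)) (r : {ffun 'I_4 -> nat}) (a : 'I_4) :
  perm_eq (insertion D (r + [ffun i => nat_of_bool (i == a)]))
          (tnth D a :: insertion D r).
Proof.
apply/permP => P; rewrite /= !count_insertion.
under eq_bigr do rewrite !ffunE mulnDr.
rewrite big_split /= addnC; congr (_ + _)%N.
by rewrite (bigD1 a) //= eqxx muln1 big1 ?addn0 // => i /negPf ->; rewrite muln0.
Qed.

End Basis.

(** * Products of formal series, graded by the power of T *)

Lemma mul_series_unit (R : realType) (f g : series R) m :
  (forall m', m' <> 0 -> f m' = 0) -> mul_series f g m = f 0 * g m.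
Proof.
move=> f0; rewrite /mul_series.
have <- : \sum_(p \in [set ((0, m) : monom * monom)]) f p.1 * g p.2 = f 0 * g m.
  by rewrite fsbig_set1.
apply/esym/fsbig_widen => [p -> /=|p [/= pm p0]]; first by rewrite add0r.
have [p1|/eqP p1] := eqVneq p.1 0; last by rewrite /= f0 ?mul0r.
by case: p0; rewrite -pm p1 add0r -p1 -surjective_pairing.
Qed.

Lemma mul_series0l (R : realType) (f g : series R) m :
  (forall m', f m' = 0) -> mul_series f g m = 0.
Proof. by move=> f0; apply: fsbig1 => p _; rewrite f0 mul0r. Qed.

Lemma mul_series0r (R : realType) (f g : series R) m :
  (forall m', g m' = 0) -> mul_series f g m = 0.
Proof. by move=> g0; apply: fsbig1 => p _; rewrite g0 mulr0. Qed.

(** On monomials with the unit variable the degree axiom alone would not exclude T-degree 0. *)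
Definition positive_degree (R : realType) (f : series R) : Prop :=
  forall m : monom, m.2 i_one = 0%N -> m.1 <= 0 -> f m = 0.

(** In a nonzero term the T-degrees of the two factors are positive and add up to [m.1], so each is
    strictly below [m.1]. This makes the WDVV equation recursive. *)
Lemma mul_series_ext (R : realType) (f f' g g' : series R) (m : monom) :
  m.2 i_one = 0%N ->
  positive_degree f -> positive_degree f' ->
  positive_degree g -> positive_degree g' ->
  (forall m' : monom, m'.1 < m.1 -> f m' = f' m') ->
  (forall m' : monom, m'.1 < m.1 -> g m' = g' m') ->
  mul_series f g m = mul_series f' g' m.
Proof.
move=> m0 f0 f0' g0 g0' ff' gg'; apply: eq_fsbigr => -[p q] /[!inE] /= pq.
have pq1 : p.1 + q.1 = m.1 by rewrite -pq.
have pq2 : (p.2 i_one + q.2 i_one = 0)%N by move: m0; rewrite -pq /= ffunE.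
have p2 : p.2 i_one = 0%N by lia.
have q2 : q.2 i_one = 0%N by lia.
have [p1|p1] := lerP p.1 0; first by rewrite f0 ?f0' ?mul0r.
have [q1|q1] := lerP q.1 0; first by rewrite g0 ?g0' ?mulr0.
by rewrite ff' ?gg' // -pq1 ?ltrDl ?ltrDr.
Qed.

(** * Consequences of the axioms for a single closed family *)

Section Closed.
Variables (R : realType) (GW : closed_family R).
Hypothesis GWax : gw_axioms GW.

Let std := std_basis R.

Lemma gw_lin0 b (s1 s2 : seq (HX R)) : GW b (s1 ++ 0 :: s2) = 0.
Proof.
have := gw_multilinear GWax b s1 s2 1 0 0.
by rewrite scale1r addr0 mul1r => /eqP; rewrite -subr_eq0 opprD addNKr oppr_eq0 => /eqP.
Qed.

Lemma gw_expand b (s1 s2 : seq (HX R)) (x : HX R) :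
  GW b (s1 ++ x :: s2)
  = x 0 i_one * GW b (s1 ++ oneX R :: s2) + x 0 i_l * GW b (s1 ++ cl_l R :: s2)
    + x 0 i_ls * GW b (s1 ++ cl_ls R :: s2) + x 0 i_pt * GW b (s1 ++ cl_pt R :: s2).
Proof.
by rewrite {1}[x]HX_expand !(gw_multilinear GWax) gw_lin0 addr0 !addrA.
Qed.

Lemma gw_unit_mid b (s1 s2 : seq (HX R)) :
  GW b (s1 ++ oneX R :: s2) = GW b (oneX R :: s1 ++ s2).
Proof. by apply: (gw_symmetric GWax); rewrite -cat1s perm_catCA. Qed.

Lemma gw_divisor_mid b (s1 s2 : seq (HX R)) (x : HX R) : b <> 0 -> homog 2 x ->
  GW b (s1 ++ x :: s2) = int2 b x * GW b (s1 ++ s2).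
Proof.
move=> b0 hx; rewrite -(gw_divisor GWax) //; last by case.
by apply: (gw_symmetric GWax); rewrite -cat1s perm_catCA perm_sym perm_rcons.
Qed.

Lemma gw_divisor_nseq b p (s : seq (HX R)) : b <> 0 ->
  GW b (nseq p (cl_l R) ++ s) = b.2%:~R ^+ p * GW b s.
Proof.
move=> b0; elim: p => [|p IH]; first by rewrite mul1r.
rewrite -[nseq _ _ ++ _]/([::] ++ cl_l R :: (nseq p (cl_l R) ++ s)).
by rewrite gw_divisor_mid ?(homog_hbasis R i_l) //= IH int2_l exprS mulrA.
Qed.

(** In the degree axiom a divisor adds 2 to both sides, while a point adds 2 to one and 4 to the
    other; as [chern1 b] is [2 * varpi b], exactly [2 * varpi b - 1] points are allowed. *)
Lemma gw_insertion_degree b (r : {ffun 'I_4 -> nat}) : r i_one = 0%N ->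
  2 * varpi b - 1 <> (r i_pt)%:Z -> GW b (insertion std r) = 0.
Proof.
move=> r0 br; rewrite insertion_std r0 /= -[nseq (r i_pt) _]cats0.
apply: (gw_degree GWax
  (ks := nseq (r i_l) 2 ++ nseq (r i_ls) 2 ++ nseq (r i_pt) 4 ++ [::])).
  have all2n n (i : 'I_4) ks (s : seq (HX R)) : all2 (@homog R) ks s ->
      all2 (@homog R) (nseq n (hdeg i) ++ ks) (nseq n (hbasis R i) ++ s).
    by move=> h; elim: n => //= n ->; rewrite homog_hbasis.
  exact/(all2n _ i_l)/(all2n _ i_ls)/(all2n _ i_pt).
rewrite !size_cat !size_nseq !sumn_cat !sumn_nseq /= /chern1 /qdim.
by move: br; rewrite /varpi; lia.
Qed.

Lemma gw_pt_degree b k : 2 * varpi b - 1 <> k%:Z -> GW b (nseq k (cl_pt R)) = 0.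
Proof.
move=> bk; pose r := [ffun i : 'I_4 => if i == i_pt then k else 0%N].
have <- : insertion std r = nseq k (cl_pt R) by rewrite insertion_std !ffunE.
by apply: gw_insertion_degree; rewrite ffunE.
Qed.

Lemma gw_unit_insertion b (x y : 'I_4) (r : {ffun 'I_4 -> nat}) :
  GW b (oneX R :: hbasis R x :: hbasis R y :: insertion std r)
  = ((b == 0) && (r == 0) && (x + y == 3)%N)%:R.
Proof.
have ins0 : (r == 0) = nilp (insertion std r).
  rewrite /nilp -count_predT count_insertion sum_nat_eq0.
  apply/eqP/forallP => [-> i|r0]; first by rewrite ffunE.
  by apply/ffunP => i; rewrite ffunE; have := r0 i; rewrite mul1n => /eqP.
rewrite (gw_unit GWax) ins0 intX_cup_hbasis.
by case: (insertion _ _) => [|? ?]; case: eqP => //=; case: eqP.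
Qed.

(** [K] collects the factorials and the exponents. Chosen before the family, it is common to two
    families under comparison and cancels. *)
Lemma d3E a b c (m : monom) : exists2 K : R, K != 0 & forall GW : closed_family R,
  d3 GW std a b c m =
  K * \sum_(B \in [set B : H2X | varpi B = m.1])
    GW B (insertion std (m.2 + [ffun i => nat_of_bool (i == a)]
      + [ffun i => nat_of_bool (i == b)] + [ffun i => nat_of_bool (i == c)])).
Proof.
eexists; last by move=> G; rewrite /d3 /partial /potential /= !mulrA; reflexivity.
rewrite !mulf_neq0 ?invr_eq0 ?pnatr_eq0 //= -lt0n.
by apply: prodn_gt0 => i; rewrite fact_gt0.
Qed.

Lemma insertionD3 (D : 4.-tuple (HX R)) (r : {ffun 'I_4 -> nat}) (a b c : 'I_4) :
  perm_eq (insertion D (r + [ffun i => nat_of_bool (i == a)]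
      + [ffun i => nat_of_bool (i == b)] + [ffun i => nat_of_bool (i == c)]))
    [:: tnth D c, tnth D b, tnth D a & insertion D r].
Proof.
rewrite (permPl (insertionD1 _ _ _)) perm_cons (permPl (insertionD1 _ _ _)).
by rewrite perm_cons insertionD1.
Qed.

Lemma d3_positive_degree a b c : a != i_one -> b != i_one -> c != i_one ->
  positive_degree (d3 GW std a b c).
Proof.
move=> a0 b0 c0 m m0 m1; have [K _ ->] := d3E a b c m.
rewrite fsbig1 ?mulr0 // => B /= Bm; apply: gw_insertion_degree; last by lia.
by rewrite !ffunE m0 ![i_one == _]eq_sym (negPf a0) (negPf b0) (negPf c0).
Qed.

(** By the unit axiom a third derivative involving the unit direction is constant, given by the
    pairing of the other two classes. *)
Lemma d3_unit a b c x y (m : monom) :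
  perm_eq [:: c; b; a] [:: i_one; x; y] -> m <> 0 \/ (x + y)%N <> 3%N ->
  d3 GW std a b c m = 0.
Proof.
move=> abc mxy; have [K _ ->] := d3E a b c m.
rewrite fsbig1 ?mulr0 // => B /= Bm.
rewrite (gw_symmetric GWax B (insertionD3 _ _ _ _ _)) !tnth_std_basis.
rewrite (gw_symmetric GWax B (t := oneX R :: hbasis R x :: hbasis R y :: insertion std m.2)).
  rewrite gw_unit_insertion.
  case: eqP => //= B0; case: eqP => //= m2; case: eqP => //= xy.
  case: mxy => //; case; case: m Bm m2 => m1 m2 /= <- ->.
  by rewrite B0.
by have := perm_map (hbasis R) abc; rewrite -(perm_cat2r (insertion std m.2)).
Qed.

(** Only the zero class contributes, through the pairing of [cl_l] with [cl_ls]. This is the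
    coefficient of the pure point derivative in the WDVV equation, to be cancelled there. *)
Lemma d3_unit_at0 : d3 GW std i_l i_ls i_one 0 <> 0.
Proof.
have [K K0 ->] := d3E i_l i_ls i_one 0; apply/eqP; rewrite mulf_neq0 //.
suff -> : \sum_(B \in [set B : H2X | varpi B = 0])
    GW B (insertion std (0 + [ffun i => nat_of_bool (i == i_l)]
      + [ffun i => nat_of_bool (i == i_ls)] + [ffun i => nat_of_bool (i == i_one)]))
    = 1 by exact: oner_neq0.
under eq_fsbigr => B _.
  rewrite (gw_symmetric GWax B (insertionD3 _ _ _ _ _)) !tnth_std_basis.
  rewrite gw_unit_insertion eqxx !andbT.
  over.
rewrite -(@fsbig_widen _ _ _ _ [set 0 : H2X]) ?fsbig_set1 ?eqxx //.
  by move=> B ->.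
by move=> B [_ /=]; case: eqP.
Qed.

End Closed.

(** * Uniqueness of the closed invariants *)

Section Comparison.
Variables (R : realType) (GW GW' : closed_family R).
Hypotheses (GWax : gw_axioms GW) (GWax' : gw_axioms GW').

Let std := std_basis R.

(** Induction on [s], expanding its head in the basis: the unit and divisor axioms settle three
    components, and the point component joins the prefix, whence the general [k]. *)
Lemma gw_eq_of_pt b :
  (forall k, GW b (nseq k (cl_pt R)) = GW' b (nseq k (cl_pt R))) ->
  forall s, GW b s = GW' b s.
Proof.
move=> ptE s; have [->|/eqP b0] := eqVneq b 0.
  by rewrite (gw_zero GWax) (gw_zero GWax').
suff H k : GW b (nseq k (cl_pt R) ++ s) = GW' b (nseq k (cl_pt R) ++ s) by exact: (H 0%N).
elim: s k => [|x s IH] k; first by rewrite cats0.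
rewrite (gw_expand GWax) (gw_expand GWax').
rewrite !gw_unit_mid // (gw_unit GWax) (gw_unit GWax').
rewrite !(gw_divisor_mid _ _ _ b0 (homog_hbasis R i_l)) //.
rewrite !(gw_divisor_mid _ _ _ b0 (homog_hbasis R i_ls)) // IH.
have -> : nseq k (cl_pt R) ++ cl_pt R :: s = nseq k.+1 (cl_pt R) ++ s.
  by rewrite -addn1 nseqD -catA.
by rewrite IH.
Qed.

Lemma gw_degree1_eq v b : basic_invariants v GW -> basic_invariants v GW' ->
  varpi b = 1 -> GW b [:: cl_pt R] = GW' b [:: cl_pt R].
Proof.
move=> vGW vGW' b1.
have b0 : b <> 0 by move=> b0; rewrite b0 in b1.
have El : b.2%:~R * GW b [:: cl_pt R] = b.2%:~R * GW' b [:: cl_pt R].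
  rewrite -int2_l -(gw_divisor_mid GWax [:: _] [::] b0 (homog_hbasis R i_l)).
  rewrite -(gw_divisor_mid GWax' [:: _] [::] b0 (homog_hbasis R i_l)) /=.
  by case: (b) => d1 d2; rewrite vGW vGW'.
have Els : b.1%:~R * GW b [:: cl_pt R] = b.1%:~R * GW' b [:: cl_pt R].
  rewrite -int2_ls -(gw_divisor_mid GWax [:: _] [::] b0 (homog_hbasis R i_ls)).
  rewrite -(gw_divisor_mid GWax' [:: _] [::] b0 (homog_hbasis R i_ls)) /=.
  by case: (b) => d1 d2; rewrite vGW vGW'.
rewrite -[LHS]mul1r -[RHS]mul1r -[1]/(1%:~R) -b1 /varpi intrD !mulrDl.
by rewrite El Els.
Qed.

(** The coefficient at [m] only involves classes in the fibre of [varpi] over [m.1]. *)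
Lemma d3_ext a b c (d : int) (m : monom) :
  (forall b s, varpi b < d -> GW b s = GW' b s) -> m.1 < d ->
  d3 GW std a b c m = d3 GW' std a b c m.
Proof.
move=> low md; have [K _ d3E] := d3E R a b c m; rewrite !d3E; congr (_ * _).
by apply: eq_fsbigr => B; rewrite inE /= => Bm; apply: low; rewrite Bm.
Qed.

(* In terms of the derivatives f_abc of the potential, the equation for the
   indices (l, l*, pt, pt) reads, away from the unit variable,
   f_333 = f_123^2 + f_223 f_113 - f_112 f_233 - f_122 f_133,
   where all f's on the right-hand side have no term of degree <= 0 in T. *)
Lemma d3_pt_eq (m : monom) : wdvv GW -> wdvv GW' -> 0 < m.1 ->
  (forall b s, varpi b < m.1 -> GW b s = GW' b s) -> m.2 i_one = 0%N ->
  d3 GW std i_pt i_pt i_pt m = d3 GW' std i_pt i_pt i_pt m.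
Proof.
move=> W W' m1 low m0.
have recE (G : closed_family R) : gw_axioms G -> wdvv G ->
    d3 G std i_l i_ls i_one 0 * d3 G std i_pt i_pt i_pt m
    = mul_series (d3 G std i_ls i_pt i_l) (d3 G std i_ls i_l i_pt) m
      + mul_series (d3 G std i_ls i_pt i_ls) (d3 G std i_l i_l i_pt) m
      - mul_series (d3 G std i_l i_ls i_l) (d3 G std i_ls i_pt i_pt) m
      - mul_series (d3 G std i_l i_ls i_ls) (d3 G std i_l i_pt i_pt) m.
  move=> Gax GW1; have := GW1 _ (std_basis_homogeneous R) i_l i_ls i_pt i_pt m.
  rewrite !sum_ginv_std.
  rewrite mul_series_unit => [|m' m'0]; last first.
    by rewrite (@d3_unit _ _ Gax _ _ _ i_l i_ls) //; left.
  (* The other three products with a unit direction vanish: their remaining indices add up to 6, 5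
     and 4 instead of 3. *)
  rewrite (mul_series0r _ _ (g := d3 _ _ i_one i_pt _)) => [|m']; last first.
    by rewrite (@d3_unit _ _ Gax _ _ _ i_pt i_pt) //; right.
  rewrite (mul_series0l _ _ (f := d3 _ _ i_ls i_pt i_one)) => [|m']; last first.
    by rewrite (@d3_unit _ _ Gax _ _ _ i_ls i_pt) //; right.
  rewrite (mul_series0r _ _ (g := d3 _ _ i_one i_l _)) => [|m']; last first.
    by rewrite (@d3_unit _ _ Gax _ _ _ i_l i_pt) //; right.
  by rewrite !addr0 add0r => <-; ring.
(* Without unit directions both factors have positive degree, so agreement below [m.1] suffices. *)
have eqM a b c x y z : i_one \notin [:: a; b; c; x; y; z] ->
    mul_series (d3 GW std a b c) (d3 GW std x y z) m
    = mul_series (d3 GW' std a b c) (d3 GW' std x y z) m.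
  rewrite !inE !negb_or ![i_one == _]eq_sym => /and5P[a0 b0 c0 x0 /andP[y0 z0]].
  apply: mul_series_ext => //; try exact: d3_positive_degree.
    by move=> m' ?; apply: d3_ext low _.
  by move=> m' ?; apply: d3_ext low _.
(* The coefficient of the point derivative has T-degree 0, below [m.1]; hence it is the same for
   both families, and being nonzero it cancels. *)
have := recE _ GWax W; rewrite !eqM // -(recE _ GWax' W').
rewrite -(d3_ext _ _ _ low) // => /eqP; rewrite -subr_eq0 -mulrBr mulf_eq0.
by rewrite (negPf (introN eqP (d3_unit_at0 GWax))) subr_eq0 => /eqP.
Qed.

Lemma gw_pt_eq (d : int) : 1 < d -> wdvv GW -> wdvv GW' ->
  (forall b s, varpi b < d -> GW b s = GW' b s) ->
  forall b k, varpi b = d -> GW b (nseq k (cl_pt R)) = GW' b (nseq k (cl_pt R)).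
Proof.
move=> d1 W W' low b k bd.
have [kd|/eqP kd] := eqVneq (2 * varpi b - 1) k%:Z; last first.
  by rewrite (gw_pt_degree GWax kd) (gw_pt_degree GWax' kd).
(* Since [d >= 2] there are at least three points; three of them are supplied by the third
   derivative. *)
have {kd} [q kq] : exists q, k = q.+3 by exists (k - 3)%N; lia.
rewrite {k}kq; set pts := nseq _ _.
have dn0 (B : H2X) : varpi B = d -> B <> 0 by move=> Bd B0; rewrite B0 in Bd; rewrite -Bd in d1.
(* On a fibre of [varpi] the coordinate [B.2] determines [B], so it can serve as the node of the
   moments. *)
apply: (@fsum_moments_inj _ _ [set B : H2X | varpi B = d] (fun B : H2X => B.2%:~R)
  (fun B => GW B pts) (fun B => GW' B pts)) => //.
- move=> [x y] [x' y'] /[!inE]; rewrite /varpi /= => <- xy /intr_inj yy.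
  by move: xy; rewrite yy => /addIr ->.
- exact: gw_finite.
- exact: gw_finite.
(* The [p] copies of [cl_l] yield the factor [B.2 ^+ p] by the divisor axiom, which applies because
   [B] is nonzero. *)
move=> p; pose r := [ffun i : 'I_4 => if i == i_l then p else if i == i_pt then q else 0%N].
have insE G : gw_axioms G ->
    \sum_(B \in [set B : H2X | varpi B = d]) B.2%:~R ^+ p * G B pts
    = \sum_(B \in [set B : H2X | varpi B = d]) G B (insertion std
      (r + [ffun i => nat_of_bool (i == i_pt)] + [ffun i => nat_of_bool (i == i_pt)]
       + [ffun i => nat_of_bool (i == i_pt)])).
  move=> Gax; apply: eq_fsbigr => B /[!inE] /= Bd.
  rewrite -(gw_divisor_nseq Gax) ?insertion_std ?ffunE /=; last exact: dn0.
  by rewrite !addr0  -[(q + _ + _ + _)%R]/((q + 1 + 1 + 1)%N) !addn1.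
have := @d3_pt_eq (d, r) W W' (lt_trans ltr01 d1) low.
have [K K0 d3E] := d3E R i_pt i_pt i_pt (d, r).
by rewrite !insE // !d3E ffunE => /(_ erefl) /(mulfI K0).
Qed.

Lemma gw_reconstruction v : wdvv GW -> wdvv GW' ->
  basic_invariants v GW -> basic_invariants v GW' ->
  forall b s, GW b s = GW' b s.
Proof.
move=> W W' vGW vGW'.
(* Induction on a strict upper bound of [varpi b]; it starts at 0 since the degree axiom kills all
   point invariants of negative degree. *)
suff H n b s : varpi b < n%:Z -> GW b s = GW' b s.
  by move=> b s; apply: (H `|varpi b|.+1); lia.
elim: n b s => [|n IH] b s bn; apply: gw_eq_of_pt => k.
  by rewrite (gw_pt_degree GWax) ?(gw_pt_degree GWax') //; lia.
have [bn'|bn'] := ltrP (varpi b) n%:Z; first exact: IH.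
have {bn bn'} bn : varpi b = n%:Z by lia.
(* Degree 0 would require -1 points, degree 1 allows a single point and is read off the basic
   invariants, and WDVV takes over from degree 2. *)
case: n => [|[|n]] in IH bn *.
- by rewrite (gw_pt_degree GWax) ?(gw_pt_degree GWax') //; lia.
- have [->|k1] := eqVneq k 1%N; first exact: gw_degree1_eq vGW vGW' bn.
  by rewrite (gw_pt_degree GWax) ?(gw_pt_degree GWax') //; lia.
- exact: gw_pt_eq W W' IH _ _ bn.
Qed.

End Comparison.

(** * Uniqueness of the open invariants *)

(** As [varpi] is onto, the number of boundary points decides: the invariants vanish for 0 and for
    at least 2, and for 1 the open-closed relation computes them. *)
Lemma ogw_reconstruction (R : realType) (GW : closed_family R)
    (OGW OGW' : open_family R) :
  ogw_axioms OGW -> open_closed GW OGW -> ogw_axioms OGW' -> open_closed GW OGW' ->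
  forall beta k s, OGW beta k s = OGW' beta k s.
Proof.
move=> ax oc ax' oc' beta [|[|k]] s.
- have im : in_im_varpi beta by exists (beta, 0); rewrite /varpi addr0.
  by rewrite (ogw_no_boundary ax) ?(ogw_no_boundary ax').
- have im : in_im_varpi beta by exists (beta, 0); rewrite /varpi addr0.
  (* With [L] = A_1 - A_2, the class [cl_ls] integrates to the coefficient of A_1. Using the same
     [eta] for both families makes the two right-hand sides identical. *)
  have eta1 : intL (cl_ls R) = 1 by rewrite /intL int2_ls.
  by rewrite (oc_relation oc s im eta1) (oc_relation oc' s im eta1).
- by rewrite (oc_two_boundary oc) ?(oc_two_boundary oc').
Qed.

(** The second clause, with arbitrary two-point values [v], also covers the values compatible with
    the divisor axiom for [l = PD(A_1)]; the third is its instance at [quadric_values]. *)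
Theorem theorem9 (R : realType) :
  (forall GW : closed_family R, gw_axioms GW -> wdvv GW ->
     forall OGW OGW' : open_family R,
       ogw_axioms OGW -> open_closed GW OGW ->
       ogw_axioms OGW' -> open_closed GW OGW' ->
       forall (beta : H2XL) (k : nat) (s : seq (HXL R)),
         OGW beta k s = OGW' beta k s)
  /\
  (forall (v : int -> int -> 'I_4 -> R) (GW GW' : closed_family R),
     gw_axioms GW -> wdvv GW -> basic_invariants v GW ->
     gw_axioms GW' -> wdvv GW' -> basic_invariants v GW' ->
     forall (b : H2X) (s : seq (HX R)), GW b s = GW' b s)
  /\
  (forall GW GW' : closed_family R,
     gw_axioms GW -> wdvv GW -> basic_invariants (quadric_values R) GW ->
     gw_axioms GW' -> wdvv GW' -> basic_invariants (quadric_values R) GW' ->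
     forall (b : H2X) (s : seq (HX R)), GW b s = GW' b s).
Proof.
split=> [GW _ _ OGW OGW'|]; first exact: ogw_reconstruction.
split=> [v|] GW GW' ax W basic ax' W' basic' b s.
  exact: (gw_reconstruction ax ax' W W' basic basic').
exact: (gw_reconstruction ax ax' W W' basic basic').
Qed.
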